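(* Let $G\le\mathrm{Sym}(\Omega)$ be a finite primitive permutation group which is not almost simple. Then $\kappa(G)=1$ if and only if $G$ is sharply $2$-transitive.
   Context: A derangement is an element of $G$ fixing no point of $\Omega$; $\kappa(G)$ is the number of conjugacy classes of $G$ consisting of derangements. $G$ is sharply $2$-transitive if it acts regularly on ordered pairs of distinct points of $\Omega$. *)

(* Defs.v *)
From mathcomp Require Import all_boot all_fingroup all_solvable.
Set Implicit Arguments. Unset Strict Implicit. Unset Printing Implicit Defensive.
Local Open Scope group_scope.

Definition derangements (Omega : finType) (G : {set {perm Omega}}) :
  {set {perm Omega}} := [set g in G | [forall x, g x != x]].

Definition kappa (Omega : finType) (G : {set {perm Omega}}) : nat :=
  #|[set C in classes G | C \subset derangements G]|.

Definition sharply_2_transitive (Omega : finType) (G : {group {perm Omega}}) :=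
  [transitive^2 G, on [set: Omega] | 'P] /\
  forall t, t \in dtuple_on 2 [set: Omega] -> 'C_G[t | ('P * 2)%act] = 1.

(* G is almost simple: T <= G <= Aut(T) for a nonabelian simple T, i.e.
   G has a nonabelian simple normal subgroup T with C_G(T) = 1 (so that
   conjugation embeds G into Aut(T)). *)
Definition almost_simple (gT : finGroupType) (G : {group gT}) :=
  exists T : {group gT}, [/\ T <| G, simple T, ~~ abelian T & 'C_G(T) = 1].

(* Main.v *)
(* Suppose the derangements form a single class, and let N be a minimal normal
   subgroup.  Nontrivial normal subgroups are transitive, hence contain
   derangements (a proper subgroup has conjugates missing some element), so
   every derangement lies in every nontrivial normal subgroup; thus C_G(N) = 1
   if N is nonabelian.
   If N is nonabelian but not simple, let S be a minimal normal subgroup of N and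
   C = C_N(S), so N = S x C with C <> 1, and each G-conjugate of S is S or lies in
   C.  Let M be a point stabilizer in N.  If M C = N then M n S is normal in N,
   and it is not S since the conjugates of S generate N; so M n S = 1, all of S^#
   consists of conjugate derangements, and S is a p-group, which is absurd.  If
   M C < N, some s in S lies in no conjugate of M C, and then s and s c are both
   derangements for any c <> 1 in C, although no conjugate of s has the form s c.
   If N is abelian, it is regular, so N^# is the set of derangements; counting
   fixed points (Burnside), |Omega| - 1 derangements force every element of G^#
   to fix at most one point, and conjugacy of N^# gives 2-transitivity.
   Conversely, in a sharply 2-transitive group there are |Omega| - 1 derangements,
   while the centralizer of a derangement is semiregular, so has order at most
   |Omega|, and the class of the derangement is as large as possible. *)
Require Import Defs.
From mathcomp Require Import all_boot all_fingroup all_solvable.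
Local Open Scope group_scope.

(** All conjugates share the identity: at most |G : K| conjugates of [K^#] cover at most |G| - |G :
    K| elements, too few for [G^#] when the index exceeds 1. *)
Lemma class_support_proper {gT : finGroupType} (G K : {group gT}) :
  K \proper G -> exists2 x, x \in G & x \notin class_support K G.
Proof.
move=> /andP[sKG nsGK]; apply/subsetPn; apply: contra nsGK => sGK.
have eqKG : class_support K G = G.
  by apply/eqP; rewrite eqEsubset sGK class_support_subG.
have := class_supportD1 G K; rewrite eqKG => defG.
have := leq_card_cover (K^# :^: G); rewrite -defG.
rewrite (eq_bigr (fun=> #|K^#|)); last first.
  by move=> _ /imsetP[x _ ->]; rewrite cardJg.
rewrite sum_nat_const card_conjugates => leG.
have sKN : K \subset 'N_G(K^#).
  by rewrite subsetI sKG normD1 normG.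
have leI : #|G : 'N_G(K^#)| <= #|G : K|.
  by rewrite dvdn_leq // indexgS.
have := leq_trans leG (leq_mul leI (leqnn _)).
have := Lagrange sKG; have := cardsD1 1 G; have := cardsD1 1 K.
rewrite !group1 -indexg_eq1 /= => -> -> /=.
move: (#|G : K|) (#|K^#|) (#|G^#|) (indexg_gt0 G K) => i k g i_gt0.
rewrite !add1n mulSn mulnC => eqi leg.
by rewrite eqn_leq i_gt0 andbT -(leq_add2r (i * k)) eqi ltnS.
Qed.

(** * Minimal normal subgroups and their direct factors *)

Lemma minnormal_norm_sub {gT : finGroupType} {A B H : {group gT}} :
  minnormal A B -> B \subset 'N(H) -> H \subset A ->
  H = 1 :> {set gT} \/ A \subset H.
Proof.
move=> /mingroupP[_ minA] nHB sHA; have [->|ntH] := eqVneq (H : {set gT}) 1.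
  by left.
by right; rewrite (minA H) // ntH.
Qed.

Section MinimalNormal.

Context {gT : finGroupType} {G N S : {group gT}}.
Hypotheses (minN : minnormal N G) (nabN : ~~ abelian N).
Hypotheses (minS : minnormal S N) (sSN : S \subset N).

Let nNG : G \subset 'N(N). Proof. by have /mingroupp/andP[] := minN. Qed.
Let nSN : N \subset 'N(S). Proof. by have /mingroupp/andP[] := minS. Qed.

(** Both [S] and [S :^ g] are normal in [N], so by minimality [S] either lies in its conjugate or
    meets it trivially, and then the two commute. *)
Lemma minnormal_conj_cent g :
  g \in G -> S :^ g = S \/ S :^ g \subset 'C_N(S).
Proof.
move=> Gg; have sSgN : S :^ g \subset N.
  by rewrite -(normsP nNG g Gg) conjSg.
have nSgN : N \subset 'N(S :^ g).
  by rewrite -(normsP nNG g Gg) normJ conjSg.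
have [TI | sS] := minnormal_norm_sub (H := S :&: S :^ g)%G minS (normsI nSN nSgN)
  (subsetIl _ _).
  right; rewrite subsetI sSgN /=; apply/commG1P/trivgP; rewrite -TI /= subsetI.
  rewrite commg_subr commg_subl (subset_trans sSgN) //=.
  by rewrite (subset_trans sSN).
left; apply/eqP; rewrite eq_sym eqEcard cardJg leqnn andbT.
by apply: subset_trans sS _; apply: subsetIr.
Qed.

(** The conjugates generate a nontrivial [G]-invariant subgroup of [N], which is all of [N]. *)
Lemma minnormal_gen_conj (K : {group gT}) :
  (forall g, g \in G -> S :^ g \subset K) -> N \subset K.
Proof.
move=> sSK; have ntS : S :!=: 1 by have /mingroupp/andP[] := minS.
have sW : <<class_support S G>> \subset N.
  by rewrite gen_subG class_support_sub_norm.
have [W1 | sNW] := minnormal_norm_sub (H := <<class_support S G>>%G) minN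
  (norms_gen (class_support_norm S G)) sW.
  case/negP: ntS; rewrite -subG1 -W1 /=.
  by rewrite (subset_trans _ (subset_gen _)) ?sub_class_support.
apply: subset_trans sNW _; rewrite gen_subG class_supportEr.
exact/bigcupsP.
Qed.

(** Otherwise [S] is abelian, all its conjugates centralize it, and [S] lies in ['Z(N)], which is 1
    or [N] by minimality. *)
Lemma minnormal_subcent : 'C_N(S) :&: S = 1.
Proof.
have ntS : S :!=: 1 by have /mingroupp/andP[] := minS.
have nCN : N \subset 'N('C_N(S)) by rewrite normsI ?normG ?norms_cent.
have [] := minnormal_norm_sub (H := 'C_N(S) :&: S)%G minS (normsI nCN nSN)
  (subsetIr _ _) => //= sSC.
have cSN : N \subset 'C_N(S).
  apply: minnormal_gen_conj => g /minnormal_conj_cent[-> | //].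
  by apply: subset_trans sSC _; apply: subsetIl.
have [Z1 | sNZ] := minnormal_norm_sub (H := 'Z(N)%G) minN
  (gFnorm_trans _ nNG) (center_sub N).
  case/negP: ntS; rewrite -subG1 -Z1 /= subsetI sSN centsC.
  by apply: subset_trans cSN _; apply: subsetIr.
by case/negP: nabN; apply: subset_trans sNZ _; apply: subsetIr.
Qed.

Lemma minnormal_mulcent : 'C_N(S) * S = N.
Proof.
have nSC : 'C_N(S) \subset 'N(S) by rewrite (subset_trans (subsetIl _ _)).
apply/eqP; rewrite -norm_joinEl // eqEsubset join_subG subsetIl sSN /=.
apply: minnormal_gen_conj => g /minnormal_conj_cent[-> | sSC].
  exact: joing_subr.
by rewrite (subset_trans sSC) ?joing_subl.
Qed.

End MinimalNormal.

(** * Derangements and fixed points of transitive groups *)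

Lemma mem_derangements {Omega : finType} {G : {group {perm Omega}}} w {x} :
  [transitive G, on [set: Omega] | 'P] -> x \in G ->
  (x \in derangements G) = (x \notin class_support 'C_G[w | 'P] G).
Proof.
move=> trG Gx; rewrite inE Gx /=; apply/forallP/idP => [dx | /negP dx a].
  apply/negP=> /imset2P[h g /setIP[Gh /astab1P hw] Gg def_x].
  case/eqP: (dx (g w)); rewrite def_x.
  by move: hw; rewrite /= /aperm conjgE !permM permK => ->.
apply/eqP => xa; apply: dx.
have [g Gg /= def_a] := atransP2 trG (in_setT w) (in_setT a).
apply/imset2P; exists (x ^ g^-1) g; rewrite ?conjgKV ?inE ?groupJ ?groupV //=.
rewrite sub1set inE /= /aperm conjgE invgK !permM.
by move: xa; rewrite def_a /aperm => ->; rewrite permK.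
Qed.

Lemma derangements_norm {Omega : finType} {G : {group {perm Omega}}} :
  G \subset 'N(derangements G).
Proof.
apply/subsetP=> g Gg; rewrite inE; apply/subsetP=> _ /imsetP[x dx ->].
move: dx; rewrite !inE => /andP[Gx /forallP dx]; rewrite groupJ //=.
apply/forallP=> a; apply: contra (dx (g^-1 a)) => /eqP.
by rewrite conjgE !permM => xa; rewrite -{2}xa permK.
Qed.

Lemma kappa_eq1 {Omega : finType} {G : {group {perm Omega}}} :
  kappa G = 1%N <-> exists2 d, d \in G & derangements G = d ^: G.
Proof.
have dJ x : x \in derangements G -> x ^: G \subset derangements G.
  move=> dx; rewrite class_sub_norm ?derangements_norm //.
split=> [/eqP/cards1P[C eqC] | [d Gd eqD]].
  have : C \in [set C0 in classes G | C0 \subset derangements G].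
    by rewrite eqC set11.
  rewrite inE => /andP[/imsetP[d Gd defC] sD]; rewrite {}defC in eqC sD.
  exists d => //.
  apply/eqP; rewrite eqEsubset sD andbT; apply/subsetP=> x dx.
  have Gx : x \in G by move: dx; rewrite inE => /andP[].
  have : x ^: G \in [set C0 in classes G | C0 \subset derangements G].
    by rewrite inE mem_classes //= dJ.
  by rewrite eqC inE => /eqP <-; apply: class_refl.
apply/eqP/cards1P; exists (d ^: G); apply/setP=> C; rewrite !inE eqD.
apply/andP/eqP => [[/imsetP[x Gx ->] sxd] | ->]; last by rewrite mem_classes.
by apply/class_eqP; apply: subsetP sxd _ (class_refl _ _).
Qed.

(* Burnside's lemma: a transitive group has average number of fixed points 1,
   and the identity accounts for the surplus that derangements compensate. *)
Lemma sum_fix_nonderangements {Omega : finType} {G : {group {perm Omega}}} :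
  [transitive G, on [set: Omega] | 'P] ->
  (#|Omega| + \sum_(g in G^# :\: derangements G) #|'Fix_'P[g]|)%N = #|G|.
Proof.
move=> trG; have := Frobenius_Cauchy (atrans_acts trG).
have -> : #|orbit 'P%act G @: [set: Omega]| = 1%N.
  have [w _ defO] := imsetP trG; apply/eqP/cards1P; exists [set: Omega].
  apply/setP=> X; rewrite inE; apply/imsetP/eqP => [[y _ ->] | ->].
    by rewrite (atransP trG).
  by exists w; rewrite ?inE.
rewrite mul1n => <-; under [RHS]eq_bigr do rewrite setTI.
rewrite [RHS](big_setD1 1 (group1 G)) /=; congr (_ + _)%N.
  rewrite -cardsT; apply: eq_card => x; rewrite in_setT; apply/esym/afix1P.
  by rewrite act1.
rewrite [RHS](big_setID (derangements G)) /=
  [X in _ = (X + _)%N]big1 ?add0n // => g.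
rewrite !inE => /andP[_ /andP[_ /forallP dg]]; apply/eqP.
rewrite cards_eq0; apply/eqP/setP=> x; rewrite in_set0; apply/negbTE.
by apply/afix1P=> /eqP; apply/negP; apply: dg.
Qed.

Lemma derangements_sub (Omega : finType) (G : {set {perm Omega}}) :
  derangements G \subset G.
Proof. by apply/subsetP=> x; rewrite inE => /andP[]. Qed.

(** In the fixed-point count each non-derangement of [G^#] contributes at least 1; the equality says
    that the sum is as small as possible, so each contributes exactly 1. *)
Lemma card_derangements_eq {Omega : finType} {G : {group {perm Omega}}} :
  [transitive G, on [set: Omega] | 'P] ->
  (#|derangements G|.+1 == #|Omega|) = [forall g in G^#, #|'Fix_'P[g]| <= 1].
Proof.
move=> trG; have [w _ _] := imsetP trG.
have sDG : derangements G \subset G^#.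
  rewrite subsetD1 derangements_sub inE group1 /=.
  by apply/forallPn; exists w; rewrite perm1 eqxx.
have fix_gt0 g : g \in G^# :\: derangements G -> 0 < #|'Fix_'P[g]|.
  rewrite !inE => /and3P[+ _ Gg]; rewrite Gg negb_forall.
  by case/existsP=> x /negPn/eqP gx; apply/card_gt0P; exists x; apply/afix1P.
have := leqif_sum (fun g Dg => leqif_eq (fix_gt0 g Dg)).
rewrite sum1_card => -[_ eqS].
have := sum_fix_nonderangements trG; rewrite (cardsD1 1 G) group1.
rewrite -[#|G^#|](cardsID (derangements G)) (setIidPr sDG) add1n -addSn => eqG.
have -> : (#|derangements G|.+1 == #|Omega|) =
  (#|G^# :\: derangements G| == \sum_(g in G^# :\: derangements G) #|'Fix_'P[g]|).
  apply/eqP/eqP => eqn; apply/eqP.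
    by rewrite -(eqn_add2l #|derangements G|.+1) -eqG -eqn.
  by rewrite -(eqn_add2r #|G^# :\: derangements G|) -eqG eqn.
rewrite eqS; apply/forall_inP/forall_inP => [fix1 g Gg | fix1 g].
  have [dg | ndg] := boolP (g \in derangements G); last first.
    by rewrite -(eqP (fix1 g _)) // inE ndg.
  rewrite (@eq_card0 _ [in 'Fix_'P[g]]) // => x; apply/negbTE.
  by apply/afix1P=> gx; move: dg; rewrite inE => /andP[_ /forallP/(_ x)/eqP].
move=> Dg; rewrite eq_sym eqn_leq fix_gt0 // andbT fix1 //.
by case/setDP: Dg.
Qed.

(** Jordan's theorem: the conjugates of a point stabilizer, proper since a transitive group fixing
    [w] is trivial, do not cover [G]. *)
Lemma transitive_derangement {Omega : finType} {G : {group {perm Omega}}} :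
  [transitive G, on [set: Omega] | 'P] -> G :!=: 1 ->
  exists d, d \in derangements G.
Proof.
move=> trG ntG; have [w _ _] := imsetP trG.
have [|x Gx dx] := class_support_proper G 'C_G[w | 'P]%G; last first.
  by exists x; rewrite (mem_derangements w).
rewrite properE subsetIl subsetI subxx /=; apply: contra ntG => sGw.
rewrite -subG1; apply/subsetP=> x Gx; rewrite inE; apply/eqP/permP=> a.
have [g Gg /= ->] := atransP2 trG (in_setT w) (in_setT a).
rewrite perm1 /aperm.
have /astab1P/= xw : x ^ g^-1 \in 'C[w | 'P].
  by apply: (subsetP sGw); rewrite groupJ ?groupV.
move: xw; rewrite /aperm conjgE invgK !permM => xw.
by rewrite -[in RHS]xw permKV.
Qed.

Lemma prim_norm_trans {Omega : finType} {G N : {group {perm Omega}}} :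
  [primitive G, on [set: Omega] | 'P] -> N <| G -> N :!=: 1 ->
  [transitive N, on [set: Omega] | 'P].
Proof.
move=> primG nsNG ntN; have [sNC | //] := prim_trans_norm primG nsNG.
case/negP: ntN; rewrite -subG1; apply/subsetP=> x /(subsetP sNC)/setIP[_ Cx].
by rewrite inE; apply/eqP/permP=> a; rewrite perm1; exact: astab_act Cx (in_setT a).
Qed.

(** * The case of a nonabelian minimal normal subgroup *)

Lemma kappa1_minnormal_abelian {Omega : finType} {G N : {group {perm Omega}}} :
  [primitive G, on [set: Omega] | 'P] -> ~ almost_simple G -> kappa G = 1%N ->
  minnormal N G -> N \subset G -> abelian N.
Proof.
move=> primG nasG /kappa_eq1[d Gd eqD] minN sNG; have [trG _] := andP primG.
have [w _ _] := imsetP trG; apply: contraT => nabN.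
have /mingroupp/andP[ntN nNG] := minN.
have nsNG : N <| G by apply/andP.
have derJ x y : x \in derangements G -> y \in derangements G ->
    exists2 g, g \in G & y = x ^ g.
  by rewrite eqD => /class_eqP <- /imsetP.
have subD (K : {group _}) x :
    K <| G -> K :!=: 1 -> x \in derangements G -> x \in K.
  move=> nsKG ntK Dx.
  have [e De] := transitive_derangement (prim_norm_trans primG nsKG ntK) ntK.
  have [Ke de] := setIdP De.
  have DGe : e \in derangements G by rewrite inE (subsetP (normal_sub nsKG)).
  have [g Gg ->] := derJ e x DGe Dx.
  by rewrite memJ_norm ?(subsetP (normal_norm nsKG)).
have ntD x : x \in derangements G -> x != 1.
  rewrite inE => /andP[_ /forallP/(_ w)]; apply: contraNneq => ->.
  by rewrite perm1.
have trN : [transitive N, on [set: Omega] | 'P] by apply: prim_norm_trans primG _ _.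
have Dd : d \in derangements G by rewrite eqD class_refl.
have Z1 : 'Z(N) = 1.
  have [//|sNZ] := minnormal_norm_sub (H := 'Z(N)%G) minN
    (gFnorm_trans _ nNG) (center_sub N).
  by case/negP: nabN; apply: subset_trans sNZ _; apply: subsetIr.
have C1 : 'C_G(N) = 1.
  apply/eqP; apply: contraT => ntC; case/negP: (ntD d Dd).
  have nsCG : 'C_G(N) <| G by rewrite /normal subsetIl normsI ?normG ?norms_cent.
  have /setIP[_ Cd] := subD 'C_G(N)%G _ nsCG ntC Dd.
  by apply/eqP/set1gP; rewrite -Z1 inE Cd (subD N).
have [S minS sSN] := minnormal_exists ntN (normG N).
have /mingroupp/andP[ntS nSN] := minS.
pose C := 'C_N(S); have eqN : C * S = N by exact: minnormal_mulcent minN minS sSN.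
have tiCS : C :&: S = 1 by exact: minnormal_subcent minN nabN minS sSN.
have ntC : C != 1.
  apply/eqP=> C_1; apply: nasG; exists N; split=> //.
  have eqSN : N = S by apply/group_inj; rewrite -eqN C_1 mul1g.
  by rewrite /simple {1}eqSN.
pose M := 'C_N[w | 'P]%G.
have nCN : N \subset 'N(C) by rewrite normsI ?normG ?norms_cent.
have nCM : M \subset 'N(C) by rewrite (subset_trans _ nCN) ?subsetIl.
have derN x : x \in N -> x \notin class_support M N -> x \in derangements G.
  move=> Nx; rewrite -mem_derangements // => /setIdP[_ dx].
  by rewrite inE (subsetP sNG).
have [sNMC | nsNMC] := boolP (N \subset C <*> M).
  (* [C] centralizes [S], and [M] normalizes both itself and [S]. *)
  have nMS : N \subset 'N(M :&: S).
    rewrite (subset_trans sNMC) // join_subG; apply/andP; split.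
      by rewrite cents_norm // (subset_trans (subsetIr N _)) ?centS ?subsetIr.
    by rewrite normsI ?normG // (subset_trans _ nSN) ?subsetIl.
  have [MS1 | sSM] := minnormal_norm_sub (H := (M :&: S)%G) minS nMS
    (subsetIr _ _).
    have derS x : x \in S -> x != 1 -> x \in derangements G.
      move=> Sx ntx; apply: derN; first exact: subsetP sSN x Sx.
      apply: contra ntx => /imset2P[m n Mm Nn def_x].
      suff: m \in M :&: S by rewrite MS1 def_x => /set1P->; rewrite conj1g.
      by rewrite inE Mm -(memJ_norm _ (subsetP nSN n Nn)) -def_x.
    have S_gt1 : 1 < #|S| by rewrite ltnNge -trivg_card_le1.
    have [x Sx ox] := Cauchy (pdiv_prime S_gt1) (pdiv_dvd _).
    have nt_prime (y : {perm Omega}) q : prime q -> #[y] = q -> y != 1.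
      by move=> pr_q oy; rewrite -order_gt1 oy prime_gt1.
    (* Elements of [S^#] are conjugate in [G], so two different prime orders cannot occur. *)
    have pS : (pdiv #|S|).-group S.
      apply/pgroupP=> q pr_q /(Cauchy pr_q)[y Sy oy].
      have [g _ def_y] := derJ x y (derS x Sx (nt_prime _ _ (pdiv_prime S_gt1) ox))
        (derS y Sy (nt_prime _ _ pr_q oy)).
      by rewrite inE -oy def_y orderJ ox.
    have [ZS1 | sSZ] := minnormal_norm_sub (H := 'Z(S)%G) minS
      (gFnorm_trans _ nSN) (center_sub S).
      by case/eqP: ntS; apply: trivg_center_pgroup pS ZS1.
    case/negP: ntS; rewrite -subG1 -tiCS subsetI subxx andbT subsetI sSN.
    by apply: subset_trans sSZ _; apply: subsetIr.
  have sNM : N \subset M.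
    (* [G] is [N] times the stabilizer of [w], and [N] normalizes [S]: every conjugate of [S] is one
       by an element fixing [w], so it stays in [M]. *)
    apply: (minnormal_gen_conj minN minS sSN) => g.
    have /(subgroup_transitiveP (in_setT w) sNG trG) <- := trN.
    rewrite normC; last by rewrite (subset_trans (subsetIl _ _)).
    case/mulsgP=> n h Nn /setIP[Gh wh] ->.
    rewrite conjsgM (normsP nSN) // subsetI -{1}(normsP nNG h Gh) conjSg sSN.
    rewrite conj_subG // (subset_trans sSM) //=.
    by rewrite (subset_trans (subsetIl _ _)) ?subsetIr.
  have /setIP[_ /astab1P dw] := subsetP sNM d (subD N d nsNG ntN Dd).
  by move: Dd; rewrite inE => /andP[_ /forallP/(_ w)/eqP].
have [|x Nx nCMx] := class_support_proper N (C <*> M)%G.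
  by rewrite properE nsNMC join_subG !subsetIl.
move: (Nx); rewrite -{1}eqN => /mulsgP[c s Cc Ss def_x].
(* If [b * s] were in [M :^ n], then [x], obtained from it by the factor [c * b^-1] in the normal
   subgroup [C], would lie in [(C <*> M) :^ n]. *)
have derCs b : b \in C -> b * s \in derangements G.
  move=> Cb; apply: derN; first by rewrite -eqN mem_mulg.
  apply: contra nCMx => /imset2P[m n Mm Nn eq_bs].
  apply/imset2P; exists ((c * b^-1) ^ n^-1 * m) n => //; last first.
    by rewrite conjMg conjgKV -eq_bs def_x mulgA mulgKV.
  rewrite groupM //; last by rewrite (subsetP (joing_subr _ _)).
  rewrite (subsetP (joing_subl _ _)) // memJ_norm ?(subsetP nCN) ?groupV //.
  by rewrite groupM ?groupV.
have Ds : s \in derangements G by rewrite -[s]mul1g derCs ?group1.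
have [b Cb ntb] := trivgPn _ ntC.
have [g Gg eq_bs] := derJ s (b * s) Ds (derCs b Cb).
have Sg : b * s \in S :^ g by rewrite eq_bs memJ_conjg.
(* A conjugate of [S] containing [b * s] forces [b] into [S] or [s] into [C], against [tiCS]. *)
have [eqS | sSC] := minnormal_conj_cent minN minS sSN g Gg.
  case/eqP: ntb; apply/set1gP; rewrite -tiCS inE Cb /=.
  by rewrite eqS groupMr in Sg.
case/eqP: (ntD s Ds); apply/set1gP; rewrite -tiCS inE Ss andbT.
by rewrite -(groupMl s Cb) (subsetP sSC).
Qed.

(** * From sharp 2-transitivity to a single class *)

Lemma mem_dtuple2 {T : finType} (a b : T) :
  ([tuple a; b] \in dtuple_on 2 [set: T]) = (a != b).
Proof.
rewrite inE /= mem_seq1 andbT; apply: andb_idr => _.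
by apply/subsetP=> z; rewrite inE.
Qed.

Lemma sharply_2_transitive_fix {Omega : finType} {G : {group {perm Omega}}} :
  sharply_2_transitive G -> [forall g in G^#, #|'Fix_'P[g]| <= 1].
Proof.
case=> _ stab1; apply/forall_inP=> g /setD1P[ntg Gg]; rewrite leqNgt.
apply: contra ntg => /card_gt1P[a [b [/afix1P/= ga /afix1P/= gb neq_ab]]].
have t2 : [tuple a; b] \in dtuple_on 2 [set: Omega].
  by rewrite mem_dtuple2.
apply/eqP/set1gP; rewrite -(stab1 _ t2) inE Gg; apply/astab1P.
by apply: val_inj; rewrite /= ga gb.
Qed.

Lemma sharply_2_transitive_kappa {Omega : finType} {G : {group {perm Omega}}} :
  sharply_2_transitive G -> kappa G = 1%N.
Proof.
move=> sh2G; have [tr2G _] := sh2G; have fix1 := sharply_2_transitive_fix sh2G.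
have trG : [transitive G, on [set: Omega] | 'P] by apply: ntransitive1 tr2G.
have cardD := eqP (etrans (card_derangements_eq trG) fix1).
have [t /dtuple_onP[t_inj _] _] := imsetP tr2G.
pose w := tnth t ord0; pose w' := tnth t ord_max.
have neq_w : w' != w by apply/eqP=> /t_inj.
have [d Dd] : exists d, d \in derangements G.
  apply/set0Pn; rewrite -card_gt0 -ltnS cardD -cardsT.
  by apply/card_gt1P; exists w', w.
have Gd := subsetP (derangements_sub _ _) d Dd.
apply/kappa_eq1; exists d => //; apply/eqP.
rewrite eq_sym eqEcard class_sub_norm ?derangements_norm //=.
have trGw := stab_ntransitive (ltn0Sn 0) (in_setT w) tr2G.
have {}trGw := ntransitive1 (ltn0Sn 0) trGw.
(* The stabilizer of [w] is transitive on the other points, which are as many as the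
   derangements. *)
have leGw : #|derangements G| <= #|'C_G[w | 'P]|.
  have w'T : w' \in [set: Omega] :\ w by rewrite !inE neq_w.
  have := dvdn_orbit 'P%act 'C_G[w | 'P] w'; rewrite (atransP trGw) // => /dvdn_leq.
  have := cardsD1 w [set: Omega]; rewrite in_setT cardsT -cardD add1n => -[<-].
  by apply; apply: cardG_gt0.
have leC : #|'C_G[d]| <= #|Omega|.
  rewrite -(card_orbit_stab 'P%act 'C_G[d] w).
  suff -> : 'C_('C_G[d])[w | 'P] = 1 by rewrite cards1 muln1 max_card.
  apply/trivgP/subsetP=> x /setIP[/setIP[Gx /cent1P cxd] /astab1P/= xw].
  apply/set1gP/eqP; apply: contraT => ntx; have /(forall_inP fix1) : x \in G^# by rewrite !inE ntx.
  (* Commuting with [d], the element [x] fixes [d w] along with [w]. *)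
  rewrite leqNgt => /negP[]; apply/card_gt1P; exists (d w), w; split.
  - by apply/afix1P; move: xw; rewrite /= /aperm -permM -cxd permM => ->.
  - exact/afix1P.
  by move: Dd; rewrite inE => /andP[_ /forallP/(_ w)].
(* The two bounds multiply to |C(d)| |D| <= |G| = |C(d)| |d^G|, where D is the set of
   derangements. *)
have := card_orbit_stab 'P%act G w; rewrite (atransP trG) // cardsT => eqG.
rewrite -index_cent1 -(leq_pmul2l (cardG_gt0 'C_G[d])) Lagrange ?subsetIl //.
by rewrite Dd -eqG leq_mul.
Qed.

(** * From a single class to sharp 2-transitivity, with an abelian normal subgroup *)

Lemma kappa1_sharply_2_transitive {Omega : finType} {G N : {group {perm Omega}}} :
  [primitive G, on [set: Omega] | 'P] -> N <| G -> N :!=: 1 -> abelian N ->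
  kappa G = 1%N -> sharply_2_transitive G.
Proof.
move=> primG nsNG ntN abN /kappa_eq1[d Gd eqD]; have [trG _] := andP primG.
have trN := prim_norm_trans primG nsNG ntN; have [sNG nNG] := andP nsNG.
have [w _ _] := imsetP trG.
(* An element fixing [a] commutes with elements of [N] carrying [a] to any [b], so it fixes [b]
   too. *)
have regN a x : x \in N -> x a = a -> x = 1.
  move=> Nx xa; apply/permP=> b; rewrite perm1.
  have [n Nn /= ->] := atransP2 trN (in_setT a) (in_setT b).
  by rewrite /aperm -permM -(centsP abN x Nx n Nn) permM xa.
have derN x : x \in N -> x != 1 -> x \in derangements G.
  move=> Nx ntx; rewrite inE (subsetP sNG) //=; apply/forallP=> a.
  by apply: contra ntx => /eqP/(regN _ _ Nx)->.
have Dd : d \in derangements G by rewrite eqD class_refl.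
have subN x : x \in derangements G -> x \in N.
  move=> Dx; have [e Ne nte] := trivgPn _ ntN.
  have := derN e Ne nte; rewrite eqD => /class_eqP eqde.
  move: Dx; rewrite eqD -eqde => /imsetP[g Gg ->].
  by rewrite memJ_norm ?(subsetP nNG).
have eqDN : derangements G = N^#.
  apply/setP=> x; apply/idP/setD1P => [Dx | [ntx Nx]]; last exact: derN.
  split; last exact: subN.
  apply: contraTneq Dx => ->; rewrite inE group1; apply/forallPn; exists w.
  by rewrite perm1 eqxx.
have cardN : #|N| = #|Omega|.
  have := card_orbit_stab 'P%act N w; rewrite (atransP trN) // cardsT.
  suff -> : 'C_N[w | 'P] = 1 by rewrite cards1 muln1.
  apply/trivgP/subsetP=> x /setIP[Nx /astab1P xw].
  by rewrite (regN w x Nx xw) group1.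
(* The derangements number |N| - 1 = |Omega| - 1, the equality case of the fixed-point count. *)
have := card_derangements_eq trG.
rewrite eqDN -cardN (cardsD1 1 N) group1 add1n eqxx => /esym fix1.
split; last first.
  move=> t /dtuple_onP[t_inj _]; apply/trivgP/subsetP=> g /setIP[Gg /astab1P gt].
  have gfix i : tnth t i \in 'Fix_'P[g].
    by apply/afix1P; rewrite -[in RHS]gt tnth_map.
  apply/set1gP/eqP; apply: contraT => ntg; have /(forall_inP fix1) : g \in G^# by rewrite !inE ntg.
  rewrite leqNgt => /negP[]; apply/card_gt1P.
  by exists (tnth t ord0), (tnth t ord_max); split; rewrite ?(inj_eq t_inj).
have dw : d w != w by move: Dd; rewrite inE => /andP[_ /forallP].
have tdw : [tuple w; d w] \in dtuple_on 2 [set: Omega].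
  by rewrite mem_dtuple2 eq_sym.
apply/imsetP; exists [tuple w; d w] => //; apply/setP=> t; apply/idP/imsetP.
  (* Here [y] in [N] takes [a] to [b], [g] conjugates [d] to [y], and [m] in [N] takes [g w] to [a].
     As [m] commutes with [y], also [d ^ (g * m) = y], so [g * m] takes [w] and [d w] to [a] and
     [b]. *)
  case/dtuple_onP=> t_inj _; pose a := tnth t ord0; pose b := tnth t ord_max.
  have [n Nn /= eqa] := atransP2 trN (in_setT w) (in_setT a).
  have [y Ny /= eqb] := atransP2 trN (in_setT a) (in_setT b).
  have nty : y != 1.
    apply/eqP=> y1; move: eqb; rewrite y1 /= /aperm perm1 => /t_inj.
    by move/(congr1 val).
  have : y \in d ^: G by rewrite -eqD derN.
  case/imsetP=> g Gg def_y.
  have [m Nm /= eqw] := atransP2 trN (in_setT (g w)) (in_setT a).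
  exists (g * m); first by rewrite groupM // (subsetP sNG).
  have mw : a = (g * m) w by rewrite permM.
  have mdw : b = (g * m) (d w).
    rewrite eqb mw /aperm -!permM -mulgA (centsP abN m Nm y Ny) def_y.
    by rewrite conjgE !mulgA mulgV mul1g.
  apply: eq_from_tnth => i; rewrite tnth_map.
  case: i => [[|[|//]] lti].
    by rewrite [LHS](_ : _ = a) //; congr tnth; apply: val_inj.
  by rewrite [LHS](_ : _ = b) //; congr tnth; apply: val_inj.
case=> g Gg ->; apply: n_act_dtuple => //.
by rewrite (subsetP (atrans_acts trG)).
Qed.

Theorem theorem2p1 (Omega : finType) (G : {group {perm Omega}}) :
  [primitive G, on [set: Omega] | 'P] ->
  ~ almost_simple G ->
  (kappa G = 1%N <-> sharply_2_transitive G).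
Proof.
move=> primG nasG; split=> [k1 | ]; last exact: sharply_2_transitive_kappa.
have [d Gd eqD] := iffLR kappa_eq1 k1.
have ntG : G :!=: 1.
  apply/trivgPn; exists d => //; apply/eqP=> d1.
  have [trG _] := andP primG; have [w _ _] := imsetP trG.
  have : d \in derangements G by rewrite eqD class_refl.
  by rewrite d1 inE => /andP[_ /forallP/(_ w)]; rewrite perm1 eqxx.
have [N minN sNG] := minnormal_exists ntG (normG G).
have /mingroupp/andP[ntN nNG] := minN.
apply: (kappa1_sharply_2_transitive primG _ ntN) => //; first exact/andP.
exact: kappa1_minnormal_abelian primG nasG k1 minN sNG.
Qed.
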